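(* Let $n\geq 4$ be even and let $F:\mathbb{F}_2^n\to\mathbb{F}_2^n$ be a quadratic APN function. Write $\Phi_F=((\Phi_F)_1,\ldots,(\Phi_F)_n)$ with coordinate functions $(\Phi_F)_i:\mathbb{F}_2^n\to\mathbb{F}_2$ (with $\Phi_F$ defined in the context). Then for each $i=1,\ldots,n$ there exist a Boolean function $f_i:\mathbb{F}_2^n\to\mathbb{F}_2$ of algebraic degree at most $n-2$ and $\lambda_i\in\mathbb{F}_2$ such that $$(\Phi_F)_i(x)=f_i(x)+\lambda_i\Big(\sum_{k=1}^{n}\prod_{j\neq k}x_j+x_1x_2\cdots x_n\Big)$$ for all $x=(x_1,\ldots,x_n)\in\mathbb{F}_2^n$.
   Context: A vectorial Boolean function $F:\mathbb{F}_2^n\to\mathbb{F}_2^n$ is quadratic if its algebraic normal form has algebraic degree exactly $2$. $F$ is almost perfect nonlinear (APN) if for every $a,b\in\mathbb{F}_2^n$ with $a\neq\mathbf{0}$ the equation $F(x)+F(x+a)=b$ has at most $2$ solutions $x$. For a quadratic APN $F$ and nonzero $a$, the set $B_a(F)=\{F(x)+F(x+a): x\in\mathbb{F}_2^n\}$ is either a linear subspace of dimension $n-1$ or the complement of such a subspace; hence there are a unique nonzero vector $\Phi_F(a)\in\mathbb{F}_2^n$ and a unique bit $\varphi_F(a)\in\mathbb{F}_2$ with $B_a(F)=\{y\in\mathbb{F}_2^n: \Phi_F(a)\cdot y=\varphi_F(a)\}$, where $u\cdot y=\sum_i u_iy_i \bmod 2$. One sets $\Phi_F(\mathbf{0})=\mathbf{0}$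 and $\varphi_F(\mathbf{0})=1$. The algebraic degree of a Boolean function is the degree of its algebraic normal form. *)

(* Defs.v *)
From HB Require Import structures.
From mathcomp Require Import all_boot all_order all_algebra.
From mathcomp Require Import ring.

Set Implicit Arguments.
Unset Strict Implicit.
Unset Printing Implicit Defensive.

Import GRing.Theory.
Local Open Scope ring_scope.

Definition anf_eval n (c : {ffun {set 'I_n} -> 'F_2}) (x : 'rV['F_2]_n) : 'F_2 :=
  \sum_(I : {set 'I_n}) c I * \prod_(i in I) x 0 i.

(* Every Boolean function has exactly one algebraic normal form (lemmas
   anf_evalK and anf_eval_inj), so the default 0 is never used. *)
Definition anf n (f : 'rV['F_2]_n -> 'F_2) : {ffun {set 'I_n} -> 'F_2} :=
  odflt 0 [pick c | [forall x, f x == anf_eval c x]].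

(* The zero function gets degree 0. *)
Definition alg_degree n (f : 'rV['F_2]_n -> 'F_2) : nat :=
  \max_(I : {set 'I_n} | anf f I != 0) #|I|.

Definition component n (F : 'rV['F_2]_n -> 'rV['F_2]_n) (i : 'I_n) (x : 'rV['F_2]_n) : 'F_2 :=
  F x 0 i.

Definition vect_alg_degree n (F : 'rV['F_2]_n -> 'rV['F_2]_n) : nat :=
  \max_(i < n) alg_degree (component F i).

Definition quadratic n (F : 'rV['F_2]_n -> 'rV['F_2]_n) : Prop :=
  vect_alg_degree F = 2%N.

Definition APN n (F : 'rV['F_2]_n -> 'rV['F_2]_n) : Prop :=
  forall a b : 'rV['F_2]_n, a != 0 -> (#|[set x | (F x + F (x + a))%R == b]| <= 2)%N.

Definition dotp n (u y : 'rV['F_2]_n) : 'F_2 := \sum_(i < n) u 0 i * y 0 i.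

Definition deriv_image n (F : 'rV['F_2]_n -> 'rV['F_2]_n) (a : 'rV['F_2]_n) :
    {set 'rV['F_2]_n} :=
  [set F x + F (x + a) | x : 'rV['F_2]_n].

Definition aff_hyperplane n (u : 'rV['F_2]_n) (e : 'F_2) : {set 'rV['F_2]_n} :=
  [set y | dotp u y == e].

(* For a != 0 and F quadratic APN, the picked pair exists (ortho_pairP) and is
   unique (aff_hyperplane_inj), so the default (0, 1) is never used. *)
Definition ortho_pair n (F : 'rV['F_2]_n -> 'rV['F_2]_n) (a : 'rV['F_2]_n) :
    'rV['F_2]_n * 'F_2 :=
  if a == 0 then (0, 1)
  else odflt (0, 1) [pick p : 'rV['F_2]_n * 'F_2 |
                      (p.1 != 0) && (deriv_image F a == aff_hyperplane p.1 p.2)].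

Definition Phi n (F : 'rV['F_2]_n -> 'rV['F_2]_n) (a : 'rV['F_2]_n) : 'rV['F_2]_n :=
  (ortho_pair F a).1.

Definition phi n (F : 'rV['F_2]_n -> 'rV['F_2]_n) (a : 'rV['F_2]_n) : 'F_2 :=
  (ortho_pair F a).2.

Lemma F2_eq0_neq (x y : 'F_2) : (x == 0) = (y == 0) -> x = y.
Proof. by case: x y => [[|[|x]] hx] [[|[|y]] hy] //= _; exact: val_inj. Qed.

Lemma aff_hyperplane_inj n (u v : 'rV['F_2]_n) (e d : 'F_2) :
  aff_hyperplane u e = aff_hyperplane v d -> u = v /\ e = d.
Proof.
move=> /setP E.
have H y : dotp u y - e = dotp v y - d.
  by apply: F2_eq0_neq; move: (E y); rewrite !inE !subr_eq0.
have dot0 w : dotp w 0 = 0 :> 'F_2 by rewrite /dotp big1 // => i _; rewrite mxE mulr0.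
have ed : e = d by move: (H 0); rewrite !dot0 !sub0r => /oppr_inj.
split=> //; apply/rowP => i; move: (H (delta_mx 0 i)); rewrite ed => /addIr.
have dotd w : dotp w (delta_mx 0 i) = w 0 i :> 'F_2.
  rewrite /dotp (bigD1 i) //= mxE !eqxx mulr1 big1 ?addr0 // => j ji.
  by rewrite mxE (negbTE ji) andbF mulr0.
by rewrite !dotd.
Qed.

Lemma anf_eval_inj n : injective (fun c => [ffun x => @anf_eval n c x]).
Proof.
move=> c d /ffunP E; apply/ffunP => I.
have [m] := ubnP #|I|; elim: m I => // m IHm I ltIm.
move: (E (\row_i (i \in I)%:R)); rewrite !ffunE /anf_eval.
rewrite (bigD1 I) // [RHS](bigD1 I) //=.
have -> : \prod_(i in I) (\row_i0 (i0 \in I)%:R : 'rV['F_2]_n) 0 i = 1.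
  by apply: big1 => i iI; rewrite mxE iI.
rewrite !mulr1 => EI; apply: (addIr (\sum_(J | J != I) d J *
   \prod_(i in J) (\row_i0 (i0 \in I)%:R : 'rV['F_2]_n) 0 i)).
rewrite -EI; congr (_ + _); apply: eq_bigr => J JI.
have [sJI|/subsetPn[i iJ iI]] := boolP (J \subset I).
  rewrite IHm //; rewrite ltnS in ltIm; apply: leq_trans ltIm.
  by apply: proper_card; rewrite properEneq JI.
by rewrite (bigD1 i) //= mxE (negbTE iI) mul0r !mulr0.
Qed.

Lemma anf_evalK n (f : 'rV['F_2]_n -> 'F_2) (x : 'rV['F_2]_n) :
  anf_eval (anf f) x = f x.
Proof.
rewrite /anf; case: pickP => [c /forallP/(_ x)/eqP -> //|no].
have cardE : (#|{: {ffun 'rV['F_2]_n -> 'F_2}}| <= #|{: {ffun {set 'I_n} -> 'F_2}}|)%N.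
  rewrite !card_ffun card_mx mul1n card_Fp // -[#|{set 'I_n}|]cardsT.
  by rewrite -powersetT card_powerset cardsT card_ord.
have [g _ gK] := inj_card_bij (@anf_eval_inj n) cardE.
case/negP: (negbT (no (g [ffun y => f y]))); apply/forallP => y.
by have /ffunP/(_ y) := gK [ffun y => f y]; rewrite !ffunE => ->.
Qed.

Lemma F2_opp n (v : 'rV['F_2]_n) : - v = v.
Proof.
by apply/rowP => i; rewrite mxE; apply/eqP; move: (v 0 i); case=> [[|[|]]].
Qed.

Lemma deg2_diff n (f : 'rV['F_2]_n -> 'F_2) x y a : (alg_degree f <= 2)%N ->
  f (x + y + a) - f (x + y) = (f (x + a) - f x) + (f (y + a) - f y) - (f a - f 0).
Proof.
move=> df; rewrite -!(anf_evalK f) /anf_eval.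
rewrite -!sumrB -big_split -sumrB; apply: eq_bigr => I _ /=.
have [->|cI] := eqVneq (anf f I) 0; first by rewrite !mul0r; ring.
have : (#|I| <= 2)%N.
  apply: leq_trans df; exact: (@leq_bigmax_cond _ (fun I => anf f I != 0) (fun I => #|I|) I cI).
rewrite leq_eqVlt ltnS leq_eqVlt ltnS leqn0; case/or3P.
- by case/cards2P=> i [j [ij ->]]; rewrite !(big_setU1, big_set1) ?inE //= !mxE; ring.
- by case/cards1P=> i ->; rewrite !big_set1 !mxE; ring.
- by rewrite cards_eq0 => /eqP->; rewrite !big_set0; ring.
Qed.

Lemma dotpDr n (u v w : 'rV['F_2]_n) : dotp u (v + w) = dotp u v + dotp u w.
Proof.
by rewrite /dotp -big_split; apply: eq_bigr => i _; rewrite mxE mulrDr.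
Qed.

Lemma ortho_pairP n (F : 'rV['F_2]_n -> 'rV['F_2]_n) (a : 'rV['F_2]_n) :
  quadratic F -> APN F -> a != 0 ->
  Phi F a != 0 /\ deriv_image F a = aff_hyperplane (Phi F a) (phi F a).
Proof.
move=> qF aF a0; rewrite /Phi /phi /ortho_pair (negbTE a0).
case: pickP => [p /andP[p0 /eqP]//|no]; exfalso.
have opp2 (t : 'F_2) : - t = t by case: t => [[|[|]]] // ?; exact: val_inj.
have add2 (v : 'rV['F_2]_n) : v + v = 0 by rewrite -{2}[v]F2_opp subrr.
pose L x := F x + F (x + a) + (F 0 + F a).
have Ladd x y : L (x + y) = L x + L y.
  apply/rowP => i.
  have d2 : (alg_degree (component F i) <= 2)%N.
    by rewrite -qF; exact: (@leq_bigmax _ (fun i => alg_degree (component F i)) i).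
  have := deg2_diff x y a d2; rewrite /component /L !opp2 !mxE => E.
  by rewrite [X in X + _]addrC E; ring.
have L0 : L 0 = 0 by rewrite /L add0r add2.
have La : L a = 0 by rewrite /L add2 [F a + _]addrC add2.
pose M := \matrix_i L (delta_mx 0 i).
have LM x : x *m M = L x.
  rewrite {2}(row_sum_delta x) (big_morph L Ladd L0) mulmx_sum_row.
  apply: eq_bigr => i _; rewrite rowK.
  case: (x 0 i) => [[|[|k]] hk] //.
    by have -> : Ordinal hk = 0 :> 'F_2; [exact: val_inj|rewrite !scale0r L0].
  by have -> : Ordinal hk = 1 :> 'F_2; [exact: val_inj|rewrite !scale1r].
have [u u0 uM] : exists2 u : 'rV['F_2]_n, u != 0 & u *m M^T = 0.
  have : kermx M^T != 0.
    rewrite -mxrank_eq0 mxrank_ker mxrank_tr subn_eq0 -ltnNge ltn_neqAle rank_leq_row andbT.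
    apply: contra a0 => fM; have /row_freeP[N MN] : row_free M by [].
    by rewrite -[a]mulmx1 -MN mulmxA LM La mul0mx.
  by case/rowV0Pn=> u /sub_kermxP uM u0; exists u.
have dL x : dotp u (L x) = 0.
  transitivity ((L x *m u^T) 0 0).
    by rewrite mxE /dotp; apply: eq_bigr => k _; rewrite [u^T _ _]mxE mulrC.
  by rewrite -LM -mulmxA -[M]trmxK -trmx_mul uM trmx0 mulmx0 mxE.
pose e := dotp u (F 0 + F a).
have sub : deriv_image F a \subset aff_hyperplane u e.
  apply/subsetP => _ /imsetP[x _ ->]; rewrite inE -subr_eq0 opp2 -dotpDr.
  by apply/eqP; exact: dL.
have [i ui] : exists i, u 0 i != 0 by apply/rV0Pn.
have ui1 : u 0 i = 1 by move: (u 0 i) ui => [[|[|]]] // ? _; exact: val_inj.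
have card_hyp : (#|aff_hyperplane u e| * 2 <= #|'rV['F_2]_n|)%N.
  rewrite muln2 -addnn -(cardsC (aff_hyperplane u e)) leq_add2l.
  rewrite -(card_imset _ (addIr (delta_mx 0 i))); apply: subset_leq_card.
  apply/subsetP => _ /imsetP[y + ->]; rewrite !inE dotpDr => /eqP->.
  have -> : dotp u (delta_mx 0 i) = 1.
    rewrite /dotp (bigD1 i) //= mxE !eqxx ui1 mulr1 big1 ?addr0 // => j ji.
    by rewrite mxE (negbTE ji) andbF mulr0.
  by rewrite -subr_eq0 addrAC subrr add0r oner_eq0.
have card_im : (#|'rV['F_2]_n| <= #|deriv_image F a| * 2)%N.
  rewrite -cardsT -sum1_card (partition_big_imset (fun x => F x + F (x + a))) /=.
  rewrite -sum_nat_const.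
  have -> : deriv_image F a = [set F x + F (x + a) | x in [set: 'rV_n]].
    by apply/setP => y; apply/imsetP/imsetP => -[x _ ->]; exists x.
  apply: leq_sum => b _; rewrite sum1_card; apply: leq_trans (aF a b a0).
  by apply: subset_leq_card; apply/subsetP => x; rewrite unfold_in => /andP[_ xb]; rewrite inE.
case/negP: (negbT (no (u, e))); rewrite u0 eqEcard sub /=.
by rewrite -(leq_pmul2r (isT : 0 < 2)%N) (leq_trans card_hyp).
Qed.

(* Main.v *)
(* For an index k, adding the ANF coefficients of a Boolean function g at the
   full set of variables and at the complement of k gives the sum of g over the
   points with x_k = 1, so it suffices that this sum vanishes for g = (Phi_F)_i.
   For u != 0, the points x with Phi_F(x) = u are the nonzero elements of the
   radical of the alternating form u . (F(y) + F(x+y) + F(0) + F(x)). As n is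
   even, this radical has even dimension, so its elements with x_k = 1 are even
   in number: an alternating minor of odd size n-1 is singular, which yields a
   nonzero radical element v with v_k = 0, and x -> x + v pairs them off. *)
Require Import Defs.
From mathcomp Require Import all_boot all_order all_algebra.
From mathcomp Require Import ring zify.

Set Implicit Arguments.
Unset Strict Implicit.
Unset Printing Implicit Defensive.

Import GRing.Theory Num.Theory.
Local Open Scope ring_scope.

(** * Characteristic 2 and kernels of alternating matrices *)

Lemma F2_cases (t : 'F_2) : t = 0 \/ t = 1.
Proof. by case: t => [[|[|]]] // ?; [left|right]; exact: val_inj. Qed.

Lemma F2_addrr (t : 'F_2) : t + t = 0.
Proof. by case: (F2_cases t) => ->; exact: val_inj. Qed.

Lemma F2_oppr (t : 'F_2) : - t = t.
Proof. by apply/esym/eqP; rewrite -addr_eq0 F2_addrr. Qed.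

Lemma F2_neq0 (t : 'F_2) : t != 0 -> t = 1.
Proof. by case: (F2_cases t) => -> //; rewrite eqxx. Qed.

Lemma F2_neq1 (t : 'F_2) : t != 1 -> t = 0.
Proof. by case: (F2_cases t) => -> //; rewrite eqxx. Qed.

Lemma F2_rowDD n (v : 'rV['F_2]_n) : v + v = 0.
Proof. by rewrite -{2}[v]F2_opp subrr. Qed.

Lemma F2_rowDK n (v : 'rV['F_2]_n) : cancel (+%R^~ v) (+%R^~ v).
Proof. by move=> x; rewrite -addrA F2_rowDD addr0. Qed.

(** Translation by [v] swaps the halves [x 0 j = 0] and [x 0 j = 1] of [P], so both have the same
    sum of [g] and cancel in characteristic 2. *)
Lemma sum_shift_invariant n (v : 'rV['F_2]_n) (j : 'I_n)
    (P : pred 'rV['F_2]_n) (g : 'rV['F_2]_n -> 'F_2) :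
  v 0 j = 1 -> (forall x, P (x + v) = P x) -> (forall x, P x -> g (x + v) = g x) ->
  \sum_(x | P x) g x = 0.
Proof.
move=> vj Pv gv; rewrite (bigID (fun x : 'rV['F_2]_n => x 0 j == 0)) /=.
rewrite [X in _ + X](reindex_inj (can_inj (F2_rowDK v))) /=.
rewrite [X in _ + X](eq_big (fun x : 'rV['F_2]_n => P x && (x 0 j == 0)) g) => [|x|x].
- exact: F2_addrr.
- by rewrite Pv mxE vj; case: (F2_cases (x 0 j)) => ->.
- by case/andP; rewrite Pv => /gv.
Qed.

(* Lifting [A] to a skew-symmetric integer matrix [B] gives
   [\det B = \det B^T = - \det B]; this is inconclusive over F_2 itself. *)
Lemma det_alternating_odd n (A : 'M['F_2]_n) :
  odd n -> A^T = A -> (forall i, A i i = 0) -> \det A = 0.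
Proof.
move=> on sA dA.
pose B := \matrix_(i, j) (if (i < j)%N then (A i j : nat)%:Z
                          else if (j < i)%N then - (A j i : nat)%:Z else 0) : 'M[int]_n.
have BT : B^T = -1 *: B.
  apply/matrixP => i j; rewrite !mxE mulN1r.
  by case: ltngtP => //=; rewrite ?opprK ?oppr0.
have B0 : \det B = 0.
  have := det_tr B; rewrite BT detZ -signr_odd on expr1 mulN1r => /eqP.
  by rewrite eqNr => /eqP.
have -> : A = map_mx intr B.
  apply/matrixP => i j; rewrite !mxE.
  case: ltngtP => [_|_|/ord_inj ->]; last by rewrite dA.
    by case: (F2_cases (A i j)) => ->.
  have -> : A i j = A j i by rewrite -{1}sA mxE.
  by rewrite mulrNz F2_oppr; case: (F2_cases (A j i)) => ->.
by rewrite det_map_mx B0.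
Qed.

Lemma alternating_ker_even n (A : 'M['F_2]_n) (k : 'I_n) :
  ~~ odd n -> A^T = A -> (forall i, A i i = 0) ->
  \sum_(x : 'rV['F_2]_n | (x *m A == 0) && (x 0 k == 1)) (1 : 'F_2) = 0.
Proof.
case: n => [|n] in A k *; first by case: k.
rewrite /= negbK => on sA dA.
case: (pickP (fun x : 'rV['F_2]_n.+1 => (x *m A == 0) && (x 0 k == 1))); last first.
  by move=> no; rewrite big_pred0.
move=> a /andP[/eqP aA /eqP ak].
have : \det (row' k (col' k A)) = 0.
  apply: det_alternating_odd on _ _ => [|j]; last by rewrite !mxE.
  by apply/matrixP => i j; rewrite !mxE -{1}sA mxE.
move/eqP/det0P => [w w0 wA].
pose v : 'rV['F_2]_n.+1 := \row_j oapp (w 0) 0 (unlift k j).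
have vk : v 0 k = 0 by rewrite mxE unlift_none.
have vl j : v 0 (lift k j) = w 0 j by rewrite mxE liftK.
have sumk (g : 'I_n.+1 -> 'F_2) : \sum_j g j = g k + \sum_j g (lift k j).
  by rewrite (bigD1_ord k).
have vAl j : (v *m A) 0 (lift k j) = 0.
  move/rowP/(_ j): wA; rewrite !mxE sumk vk mul0r add0r => wA; rewrite -[RHS]wA.
  by apply: eq_bigr => i _; rewrite vl !mxE.
(* By the choice of [w], only coordinate [k] of [v *m A] is still open. Pairing with the kernel
   element [a] gives 0 by symmetry of [A], and [a 0 k = 1] isolates that coordinate. *)
have vA : v *m A = 0.
  have : (v *m A *m a^T) 0 0 = 0.
    by rewrite -mulmxA -{1}sA -trmx_mul aA trmx0 mulmx0 mxE.
  rewrite mxE sumk big1 => [|j _]; last by rewrite vAl mul0r.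
  rewrite addr0 [a^T _ _]mxE ak mulr1 => vAk; apply/rowP => j; rewrite [RHS]mxE.
  by case: (unliftP k j) => [i ->|->].
have [j wj] : exists j, w 0 j != 0 by apply/rV0Pn.
have vj : v 0 (lift k j) = 1 by rewrite vl; exact: F2_neq0.
apply: (sum_shift_invariant (j := lift k j) (v := v)) => //= x.
by rewrite mulmxDl vA addr0 mxE vk addr0.
Qed.

(** * Top ANF coefficients as sums over a coordinate hyperplane *)

(** A variable outside [k |: I] is free, and flipping it pairs off the points. If there is none,
    only the all-ones point contributes. *)
Lemma sum_hyperplane_monomial n (I : {set 'I_n}) (k : 'I_n) :
  \sum_(x : 'rV['F_2]_n | x 0 k == 1) \prod_(i in I) x 0 i = (k |: I == setT)%:R.
Proof.
have [IT|] := eqVneq (k |: I) setT; last first.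
  rewrite -subTset => /subsetPn[j _]; rewrite !inE negb_or => /andP[jk jI].
  apply: (sum_shift_invariant (j := j) (v := delta_mx 0 j)); first by rewrite mxE !eqxx.
    by move=> x; rewrite !mxE (eq_sym k) (negbTE jk) andbF addr0.
  move=> x _; apply: eq_bigr => i iI; rewrite !mxE.
  by case: (i =P j) jI => [<-|_ _]; [rewrite iI|rewrite andbF addr0].
rewrite (bigD1 (const_mx 1)) ?mxE //= big1 => [|i _]; last by rewrite mxE.
rewrite big1 ?addr0 // => x /andP[/eqP xk x1].
have [i xi] : exists i, x 0 i != 1.
  apply/existsP; rewrite -negb_forall; apply: contra x1 => /forallP x1.
  by apply/eqP/rowP => i; rewrite mxE; apply/eqP.
have : i \in k |: I by rewrite IT inE.
rewrite !inE => /orP[/eqP ik|iI]; first by rewrite ik xk eqxx in xi.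
by rewrite (bigD1 i) //= (F2_neq1 xi) mul0r.
Qed.

Lemma sum_hyperplane_anf n (f : 'rV['F_2]_n -> 'F_2) (k : 'I_n) :
  \sum_(x : 'rV['F_2]_n | x 0 k == 1) f x = anf f setT + anf f [set~ k].
Proof.
under eq_bigr do rewrite -anf_evalK /anf_eval.
rewrite exchange_big /=.
under eq_bigr do rewrite -mulr_sumr sum_hyperplane_monomial.
have Tk : [set~ k] != setT :> {set 'I_n}.
  by apply/eqP => /setP/(_ k); rewrite !inE eqxx.
rewrite (bigD1 setT) // (bigD1 [set~ k]) //= setUT setUCr !eqxx !mulr1.
rewrite big1 ?addr0 // => I /andP[IT Ik]; case: eqP => [kI|]; last by rewrite mulr0.
case/negP: Ik; have kNI : k \notin I.
  by apply: contra IT => kI'; rewrite -kI (setUidPr _) ?sub1set.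
apply/eqP/setP => i; move/setP/(_ i): kI; rewrite !inE.
by case: eqP => [->|] //=; rewrite (negbTE kNI).
Qed.

Lemma anf_anf_eval n (c : {ffun {set 'I_n} -> 'F_2}) : anf (anf_eval c) = c.
Proof. by apply: anf_eval_inj; apply/ffunP => x; rewrite !ffunE anf_evalK. Qed.

(** * Polar forms of a quadratic APN function and their radicals *)

(** For quadratic [F], this is the alternating bilinear form attached to [dotp u (F x)]. It vanishes
    for all [y] exactly when the derivative of that function in direction [x] is constant. *)
Definition polar n (F : 'rV['F_2]_n -> 'rV['F_2]_n) (u x y : 'rV['F_2]_n) : 'F_2 :=
  dotp u (F y + F (y + x) + (F 0 + F x)).

Definition polar_mx n (F : 'rV['F_2]_n -> 'rV['F_2]_n) (u : 'rV['F_2]_n) : 'M['F_2]_n :=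
  \matrix_(i, j) polar F u (delta_mx 0 i) (delta_mx 0 j).

Lemma dotp0r n (u : 'rV['F_2]_n) : dotp u 0 = 0.
Proof. by rewrite /dotp big1 // => i _; rewrite mxE mulr0. Qed.

Lemma dotp_delta n (u : 'rV['F_2]_n) (i : 'I_n) : dotp u (delta_mx 0 i) = u 0 i.
Proof.
rewrite /dotp (bigD1 i) //= mxE !eqxx mulr1 big1 ?addr0 // => j ji.
by rewrite mxE (negbTE ji) andbF mulr0.
Qed.

(** Additivity already gives linearity, since the only scalars are 0 and 1. *)
Lemma additive_rowE n (g : 'rV['F_2]_n -> 'F_2) (y : 'rV['F_2]_n) :
  (forall x z, g (x + z) = g x + g z) -> g y = \sum_j y 0 j * g (delta_mx 0 j).
Proof.
move=> gD; have g0 : g 0 = 0 by rewrite -[0]addr0 gD F2_addrr.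
rewrite {1}[y]row_sum_delta (big_morph g gD g0); apply: eq_bigr => j _.
by case: (F2_cases (y 0 j)) => ->; rewrite ?scale0r ?mul0r ?scale1r ?mul1r.
Qed.

Lemma polar_sym n (F : 'rV['F_2]_n -> 'rV['F_2]_n) u x y : polar F u x y = polar F u y x.
Proof.
by rewrite /polar (addrC y x); congr dotp; apply/rowP => i; rewrite !mxE; ring.
Qed.

Lemma polarxx n (F : 'rV['F_2]_n -> 'rV['F_2]_n) u x : polar F u x x = 0.
Proof. by rewrite /polar F2_rowDD (addrC (F x)) F2_rowDD dotp0r. Qed.

(** Translation by a basis vector on which [u] takes the value 1 exchanges the hyperplane with its
    complement. *)
Lemma card_aff_hyperplane n (u : 'rV['F_2]_n) (e : 'F_2) :
  u != 0 -> (#|aff_hyperplane u e| * 2)%N = #|'rV['F_2]_n|.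
Proof.
case/rV0Pn=> i /F2_neq0 ui; rewrite muln2 -addnn -[RHS](cardsC (aff_hyperplane u e)).
congr (_ + _)%N; rewrite -(card_imset _ (addIr (delta_mx 0 i))); congr #|pred_of_set _|.
apply/setP => y; rewrite -[y](F2_rowDK (delta_mx 0 i)) (mem_imset _ _ (addIr _)).
rewrite !inE [in RHS]dotpDr dotp_delta ui.
by case: (F2_cases (dotp u (y + delta_mx 0 i))) => ->; case: (F2_cases e) => ->.
Qed.

Section Quadratic.
Variables (n : nat) (F : 'rV['F_2]_n -> 'rV['F_2]_n).
Hypothesis (F_quadratic : quadratic F).

Lemma polarDr u x y z : polar F u x (y + z) = polar F u x y + polar F u x z.
Proof.
rewrite /polar -dotpDr; congr (dotp u _); apply/rowP => i.
have d2 : (alg_degree (component F i) <= 2)%N.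
  by rewrite -F_quadratic; exact: (@leq_bigmax _ (fun i => alg_degree (component F i)) i).
have := deg2_diff y z x d2; rewrite /component !F2_oppr !mxE => E.
by rewrite [X in X + _]addrC E; ring.
Qed.

Lemma polar_mx_ker u x : (x *m polar_mx F u == 0) = [forall y, polar F u x y == 0].
Proof.
have xA j : (x *m polar_mx F u) 0 j = polar F u x (delta_mx 0 j).
  rewrite mxE polar_sym (additive_rowE _ (polarDr u _)); apply: eq_bigr => i _.
  by rewrite mxE polar_sym.
apply/eqP/forallP => [xA0 y|p0].
  rewrite (additive_rowE _ (polarDr u x)) big1 // => j _.
  by rewrite -xA xA0 mxE mulr0.
by apply/rowP => j; rewrite xA mxE; apply/eqP.
Qed.

Hypothesis (F_APN : APN F).

(** If [x] lies in the radical, [dotp u] is constant on [deriv_image F x], which thus lies in a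
    hyperplane normal to [u]. Being itself a hyperplane, it equals that one by cardinality, and
    normal vectors are unique. *)
Lemma Phi_eq_radical u x : u != 0 -> x != 0 ->
  (Phi F x == u) = (x *m polar_mx F u == 0).
Proof.
move=> u0 x0; have [p0 imE] := ortho_pairP F_quadratic F_APN x0.
rewrite polar_mx_ker; set p := Phi F x in p0 imE *.
have dim y : F y + F (y + x) \in deriv_image F x by apply/imsetP; exists y.
apply/eqP/forallP => [<- y|up].
  have: forall z, dotp p (F z + F (z + x)) = phi F x.
    by move=> z; move: (dim z); rewrite imE inE => /eqP.
  by move=> E; rewrite /polar dotpDr E -{2}[x]add0r E F2_addrr.
have sub : deriv_image F x \subset aff_hyperplane u (dotp u (F 0 + F x)).
  apply/subsetP => _ /imsetP[y _ ->]; rewrite inE -subr_eq0 F2_oppr -dotpDr.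
  exact: up.
have: aff_hyperplane p (phi F x) = aff_hyperplane u (dotp u (F 0 + F x)).
  apply/eqP; rewrite -imE eqEcard sub imE -(leq_pmul2r (isT : 0 < 2)%N).
  by rewrite (card_aff_hyperplane _ u0) (card_aff_hyperplane _ p0) leqnn.
by case/aff_hyperplane_inj.
Qed.

(** Grouping the points by the value [u] of [Phi F] makes the summand constant on each class; for
    [u != 0] the class is the part of a radical with [x 0 k = 1]. *)
Lemma sum_hyperplane_Phi (i k : 'I_n) : ~~ odd n ->
  \sum_(x : 'rV['F_2]_n | x 0 k == 1) Phi F x 0 i = 0.
Proof.
move=> n_even; rewrite (partition_big (Phi F) predT) //= big1 // => u _.
under eq_bigr => x /andP[_ /eqP ->] do rewrite -[u 0 i]mulr1.
rewrite -mulr_sumr; have [->|u0] := eqVneq u 0; first by rewrite mxE mul0r.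
rewrite (eq_bigl (fun x => (x *m polar_mx F u == 0) && (x 0 k == 1))).
  rewrite alternating_ker_even ?mulr0 // => [|j]; last by rewrite mxE polarxx.
  by apply/matrixP => a b; rewrite !mxE polar_sym.
move=> x; rewrite andbC; case: (x 0 k =P 1) => xk; rewrite ?andbF // !andbT.
(* The condition [x 0 k = 1] excludes the zero vector, which lies in every radical although
   [Phi F 0 = 0]. *)
apply: Phi_eq_radical => //; apply/eqP => x0; move: xk.
by rewrite x0 mxE => /eqP; rewrite eq_sym oner_eq0.
Qed.

End Quadratic.

Theorem theorem3 (n : nat) (F : 'rV['F_2]_n -> 'rV['F_2]_n)
    (n_ge4 : (4 <= n)%N) (n_even : ~~ odd n)
    (F_quadratic : quadratic F) (F_APN : APN F) (i : 'I_n) :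
  exists (f : 'rV['F_2]_n -> 'F_2) (lambda : 'F_2),
    (alg_degree f <= n - 2)%N /\
    forall x : 'rV['F_2]_n,
      component (Phi F) i x =
        f x + lambda * (\sum_(k < n) \prod_(j < n | j != k) x 0 j
                        + \prod_(j < n) x 0 j).
Proof.
set g := component (Phi F) i.
(* The function [f] is the ANF of [g] truncated at degree [n - 2], and [lambda] is the coefficient
   of the full monomial. *)
pose c := [ffun I : {set 'I_n} => if (#|I| <= n - 2)%N then anf g I else 0].
exists (anf_eval c), (anf g setT); split.
  apply/bigmax_leqP => I; rewrite anf_anf_eval ffunE.
  by case: ifP => // _; rewrite eqxx.
(* All coefficients in degree [n - 1] agree with the top one, so a single [lambda] serves for both
   degrees. *)
have gk k : anf g [set~ k] = anf g setT.
  apply/esym/eqP; rewrite -subr_eq0 F2_oppr -sum_hyperplane_anf.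
  by apply/eqP; exact: sum_hyperplane_Phi.
move=> x; rewrite -[LHS]anf_evalK /anf_eval.
rewrite (bigID (fun I : {set 'I_n} => (#|I| <= n - 2)%N)) /=; congr (_ + _).
  rewrite [RHS](bigID (fun I : {set 'I_n} => (#|I| <= n - 2)%N)) /= [X in _ = _ + X]big1 ?addr0.
    by apply: eq_bigr => I cI; rewrite ffunE cI.
  by move=> I cI; rewrite ffunE (negbTE cI) mul0r.
rewrite (bigD1 setT) /=; last by rewrite cardsT card_ord -ltnNge; lia.
rewrite mulrDr addrC; congr (_ + _); last first.
  by congr (_ * _); apply: eq_bigl => j; rewrite inE.
rewrite mulr_sumr.
(* The monomials left over, of degree exactly [n - 1], are those omitting a single variable. *)
have cardk (I : {set 'I_n}) :
    (~~ (#|I| <= n - 2)%N && (I != setT)) = (I \in [set [set~ k] | k : 'I_n]).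
  have nI := cardsC I; rewrite card_ord in nI.
  have -> : (I != setT) = (0 < #|~: I|)%N.
    by rewrite lt0n cards_eq0 -(inj_eq (@setC_inj _)) setCT.
  have -> : ~~ (#|I| <= n - 2)%N && (0 < #|~: I|)%N = (#|~: I| == 1)%N by lia.
  apply/cards1P/imsetP => [[k Ik]|[k _ ->]]; exists k => //.
    by rewrite -Ik setCK.
  by rewrite setCK.
under eq_bigl do rewrite cardk.
rewrite big_imset /=; last by move=> a b _ _ /setC_inj/set1_inj.
apply: eq_bigr => k _; rewrite gk; congr (_ * _).
by apply: eq_bigl => j; rewrite !inE.
Qed.
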